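(* Let $\mathrm{Ext}(A,f,(d_i:i\in I))$ and $\mathrm{Ext}(A',f',(d_i':i\in I'))$ be two indecomposable semiregular extensions. They are isomorphic as quandles if and only if there exist a bijection $\pi:I\to I'$, a group isomorphism $\psi:A\to A'$, and an element $a\in A'$ such that (E1) $\psi f=f'\psi$, and (E2) $\psi(d_i)-d'_{\pi(i)}\in a+\mathrm{Im}(1-f')$ for every $i\in I$.
   Context: For an abelian group $A$, an automorphism $f$ of $A$, a nonempty set $I$ and a tuple $\bar d=(d_i:i\in I)$ of elements of $A$, the semiregular extension $\mathrm{Ext}(A,f,\bar d)$ is the quandle on the set $I\times A$ with operation $(i,a)*(j,b)=(j,(1-f)(a)+f(b)+d_i-d_j)$, where $1$ is the identity map. For a quandle $Q$ with left translations $L_x(y)=x*y$, the orbits of $Q$ are the orbits on $Q$ of the permutation group $\langle L_aL_b^{-1}:a,b\in Q\rangle$. The extension is called indecomposable if its orbits are exactly the fibers $\{i\}\times A$, $i\in I$; equivalently, the group $A$ is generated by $\mathrm{Im}(1-f)\cup\{d_i-d_j:i,j\in I\}$. *)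

(* Defs.v *)
From mathcomp Require Import all_boot all_algebra.
From mathcomp Require Import boolp classical_sets.

Set Implicit Arguments.
Unset Strict Implicit.
Unset Printing Implicit Defensive.

Import GRing.Theory.
Local Open Scope ring_scope.
Local Open Scope classical_set_scope.

Record quandle := Quandle {
  qcarrier :> Type;
  qop : qcarrier -> qcarrier -> qcarrier;
  qop_idem : forall x, qop x x = x;
  qop_distr : forall x y z, qop x (qop y z) = qop (qop x y) (qop x z);
  qop_bij : forall x, bijective (qop x)
}.

Definition ltrans (Q : quandle) (x : Q) : Q -> Q := qop x.

Definition quandle_isomorphic (Q Q' : quandle) : Prop :=
  exists phi : Q -> Q',
    bijective phi /\ {morph phi : x y / qop x y >-> qop x y}.

(* When S consists of permutations of T, this is the subgroup of Sym(T)
   generated by S. *)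
Inductive perm_gen (T : Type) (S : set (T -> T)) : (T -> T) -> Prop :=
| perm_gen_sub g : S g -> perm_gen S g
| perm_gen_id : perm_gen S id
| perm_gen_comp g h : perm_gen S g -> perm_gen S h -> perm_gen S (g \o h)
| perm_gen_inv g h : perm_gen S g -> cancel g h -> cancel h g -> perm_gen S h.

(* Here h is the inverse of the left translation L_b. *)
Definition dis_generators (Q : quandle) : set (Q -> Q) :=
  [set g | exists a b : Q, exists h : Q -> Q,
     [/\ cancel (ltrans b) h, cancel h (ltrans b) & g = ltrans a \o h]].

Definition qorbit (Q : quandle) (x : Q) : set Q :=
  [set y | exists2 g, perm_gen (@dis_generators Q) g & g x = y].

Section SemiregularExtension.
Variables (A : zmodType) (f : {additive A -> A}) (I : Type) (d : I -> A).

Definition ext_op (x y : I * A) : I * A :=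
  (y.1, (idfun \- f) x.2 + f y.2 + d x.1 - d y.1).

Lemma ext_op_idem x : ext_op x x = x.
Proof. by case: x => i a; rewrite /ext_op /= subrK addrK. Qed.

Lemma ext_op_distr x y z :
  ext_op x (ext_op y z) = ext_op (ext_op x y) (ext_op x z).
Proof.
have opE p q : ext_op p q = (q.1, p.2 - f p.2 + d p.1 + (f q.2 - d q.1)).
  by rewrite /ext_op /= addrA; congr (_, _ - _); rewrite addrAC.
case: x y z => [i a] [j b] [k c]; rewrite !opE /=; congr (_, _).
move: (a - f a + d i) => u.
have subE v w : (u + v) - (u + w) = v - w by rewrite opprD addrACA subrr add0r.
have affE v w t :
    u + v - f (u + v) + t + (f (u + w) - d k) = u + v + t + (f (w - v) - d k).
  rewrite -(subE w v) raddfB addrAC -!addrA; congr (_ + (_ + _)).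
  by rewrite [RHS]addrC -!addrA [LHS]addrCA.
rewrite affE -(addrA u (f b - d j)) subrK -[RHS]addrA; congr (_ + _).
rewrite [RHS]addrA -raddfD; congr (f _ - _).
rewrite opprB -!addrA; congr (_ + _).
by rewrite [LHS]addrCA [RHS]addrA [RHS]addrC -[RHS]addrA.
Qed.

Lemma ext_op_bij (fbij : bijective f) x : bijective (ext_op x).
Proof.
case: fbij => g fK gK; case: x => i a.
exists (fun y => (y.1, g (y.2 + d y.1 - d i - (idfun \- f) a))) => -[j b].
  by rewrite /ext_op /= subrK addrK [_ + f b]addrC addrK fK.
by rewrite /ext_op /= gK [_ + (_ - _)]addrC subrK subrK addrK.
Qed.

Definition Ext (fbij : bijective f) : quandle :=
  Quandle ext_op_idem ext_op_distr (ext_op_bij fbij).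

Definition fiber (i : I) : set (I * A) := [set x | x.1 = i].

Definition indecomposable (fbij : bijective f) : Prop :=
  range (@qorbit (Ext fbij)) = range fiber.

End SemiregularExtension.

(* Main.v *)
Require Import Defs.
From HB Require Import structures.
From mathcomp Require Import all_boot all_algebra.
From mathcomp Require Import boolp classical_sets.

(** An isomorphism has to respect the translations of the fibers, because
    these come from the quandle structure.  Indeed, two left translations of
    an extension differ by a translation [(j, b) |-> (j, b + g)], the same [g]
    on every fiber, where [g] is a difference of two values of
    [c (i, a) = (1 - f)(a) + d_i].  So the displacement group consists of
    simultaneous translations of the fibers, and indecomposability says that
    every [g] in [A] occurs ([morph_intertwines]).  A homomorphism [phi] of
    extensions carries differences of left translations to differences of left
    translations, hence intertwines the translation by [g] with the
    translation by some [psi g]; [psi] is then additive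
    ([translation_morphism]).  Consequently
    [phi (i, b) = (pi i, psi b + e_i)], where [e_i] is the second component of
    [phi (i, 0)], and both [pi] and [psi] are bijective when [phi] is, since
    the inverse of [phi] has the same shape.

    The maps of this shape can be tested directly, for arbitrary extensions
    ([affine_morphP]): such a map is a homomorphism exactly when
    [psi f = f' psi] and [psi d_i - d'_(pi i) - (1 - f')(e_i)] is independent
    of [i].  If [a] is the common value, the latter is condition (E2), the
    elements [(1 - f')(e_i)] being the members of [Im (1 - f')] that occur in
    it.  So both implications of the theorem are readings of one computation;
    from right to left, the elements [e_i] are chosen as witnesses of (E2). *)

Set Implicit Arguments.
Unset Strict Implicit.

Import GRing.Theory.
Local Open Scope ring_scope.
Local Open Scope classical_set_scope.

(** * Translations of the fibers *)

Section Shift.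
Variables (I : Type) (A : zmodType).
Implicit Types (x : I * A) (g h : A).

Definition shift g x : I * A := (x.1, x.2 + g).

Lemma shift0 x : shift 0 x = x.
Proof. by case: x => i a; rewrite /shift addr0. Qed.

Lemma shiftD g h x : shift (g + h) x = shift g (shift h x).
Proof. by rewrite /shift /= [g + h]addrC addrA. Qed.

Lemma shiftK g : cancel (shift g) (shift (- g)).
Proof. by move=> x; rewrite -shiftD addNr shift0. Qed.

Lemma shiftNK g : cancel (shift (- g)) (shift g).
Proof. by move=> x; rewrite -shiftD subrr shift0. Qed.

Lemma shift_free x g h : shift g x = shift h x -> g = h.
Proof. by case=> /addrI. Qed.

Variables (f : {additive A -> A}) (d : I -> A).

(** In [x * y], the left factor contributes this element and nothing else. *)
Definition translation_part x : A := x.2 - f x.2 + d x.1.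

Lemma ext_opE x y :
  ext_op f d x y = (y.1, translation_part x + (f y.2 - d y.1)).
Proof.
by rewrite /ext_op /translation_part /= addrA; congr (_, _ - _); rewrite addrAC.
Qed.

(** Any two left translations differ by a translation of the fibers.  This is
    stated without inverting [ext_op y], so that a homomorphism can be applied
    to both sides. *)
Lemma ext_op_shift x y z :
  ext_op f d x z =
  shift (translation_part x - translation_part y) (ext_op f d y z).
Proof.
rewrite !ext_opE /shift /=; congr (_, _).
by rewrite [RHS]addrC [RHS]addrA subrK.
Qed.

End Shift.

(** * Maps that intertwine translations *)

Section Intertwining.
Variables (I I' : Type) (A A' : zmodType).

Definition intertwines (phi : I * A -> I' * A') (g : A) (g' : A') : Prop :=
  forall x, phi (shift g x) = shift g' (phi x).

(** Such a map is determined, up to [psi], by its values at the points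
    [(i, 0)]. *)
Lemma intertwines_affine (phi : I * A -> I' * A') (psi : A -> A') :
  (forall g, intertwines phi g (psi g)) ->
  forall x, phi x = ((phi (x.1, 0)).1, psi x.2 + (phi (x.1, 0)).2).
Proof.
move=> psiP [i b]; have := psiP b (i, 0).
by rewrite /shift /= add0r => ->; rewrite addrC.
Qed.

Lemma intertwines_base_cancel (phi : I * A -> I' * A') (psi : A -> A')
    (chi : I' * A' -> I * A) :
  (forall g, intertwines phi g (psi g)) -> cancel chi phi ->
  cancel (fun i' => (chi (i', 0)).1) (fun i => (phi (i, 0)).1).
Proof.
move=> psiP chiK i'; have := chiK (i', 0).
by rewrite (intertwines_affine psiP) => -[].
Qed.

End Intertwining.

Lemma intertwines_translation_cancel (I I' : Type) (A A' : zmodType)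
    (phi : I * A -> I' * A') (chi : I' * A' -> I * A)
    (psi : A -> A') (omega : A' -> A) :
  inhabited I' ->
  (forall g, intertwines phi g (psi g)) ->
  (forall g', intertwines chi g' (omega g')) ->
  cancel chi phi -> cancel omega psi.
Proof.
move=> [i'] psiP omegaP chiK g'; apply: (@shift_free _ _ (i', 0)).
by rewrite -{1}[(i', 0)]chiK -psiP -omegaP chiK.
Qed.

(** * Homomorphisms of indecomposable extensions *)

Section Homomorphism.
Variables (A : zmodType) (f : {additive A -> A}) (fbij : bijective f).
Variables (I : Type) (d : I -> A).
Variables (A' : zmodType) (f' : {additive A' -> A'}).
Variables (I' : Type) (d' : I' -> A').
Variable phi : I * A -> I' * A'.
Hypothesis phiM : {morph phi : x y / ext_op f d x y >-> ext_op f' d' x y}.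

(** A generator [L_x L_y^-1] translates the fibers by the difference of the
    translation parts of [x] and [y], and its counterpart on the other side is
    [L_(phi x) L_(phi y)^-1]; both properties survive composition and
    inversion. *)
Lemma perm_gen_intertwines (p : I * A -> I * A) :
  perm_gen (@dis_generators (Ext d fbij)) p ->
  exists2 g, p =1 shift g & exists g', intertwines phi g g'.
Proof.
elim=> {p} [_ [x [y [h [_ hK ->]]]]| |p q _ [g pE [g' gP]] _ [k qE [k' kP]]
           |p q _ [g pE [g' gP]] _ qK].
- have yhE z : ext_op f d y (h z) = z by exact: hK.
  have xhE z : ext_op f d x (h z) =
      shift (translation_part f d x - translation_part f d y) z.
    by rewrite (ext_op_shift f d x y) yhE.
  exists (translation_part f d x - translation_part f d y) => //.
  exists (translation_part f' d' (phi x) - translation_part f' d' (phi y)) => z.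
  by rewrite -xhE phiM (ext_op_shift _ _ (phi x) (phi y)) -phiM yhE.
- by exists 0 => [x|]; [rewrite shift0 | exists 0 => x; rewrite !shift0].
- exists (g + k) => [x|]; first by rewrite /= qE pE shiftD.
  by exists (g' + k') => x; rewrite !shiftD gP kP.
- exists (- g) => [x|]; first by rewrite -{2}[x]qK pE shiftK.
  by exists (- g') => x; rewrite -[in RHS](shiftNK g x) gP shiftK.
Qed.

Hypotheses (I_neq0 : inhabited I) (indec : indecomposable d fbij).

(** By indecomposability the orbit of [(i, 0)] is the whole fiber, so some
    displacement maps [(i, 0)] to [(i, g)]; being a translation of the fibers,
    it is then the translation by [g]. *)
Lemma morph_intertwines (g : A) : exists g', intertwines phi g g'.
Proof.
case: I_neq0 => i.
have [j _ jE] : range (@fiber A I) (@qorbit (Ext d fbij) (i, 0)).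
  by rewrite -indec; exists (i, 0).
have ij : i = j.
  have : fiber j ((i, 0) : I * A).
    by rewrite jE; exists id => //; apply: perm_gen_id.
  by [].
have [p pP pE] : @qorbit (Ext d fbij) (i, 0) (i, g) by rewrite -jE ij.
have [k kE kP] := perm_gen_intertwines pP.
by move: pE; rewrite kE => -[]; rewrite add0r => <-.
Qed.

(** Additivity comes for free: the target translation is determined by its
    effect on one point, and translations compose additively. *)
Lemma translation_morphism :
  exists psi : {additive A -> A'}, forall g, intertwines phi g (psi g).
Proof.
have [psi psiP] := choice morph_intertwines.
case: I_neq0 => i.
have psiB : zmod_morphism psi.
  move=> g h; apply: (@shift_free _ _ (phi (shift h (i, 0)))).
  by rewrite -psiP -shiftD subrK [in RHS]psiP -shiftD subrK psiP.
pose psiZ := GRing.isZmodMorphism.Build A A' psi psiB.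
pose psiA : {additive A -> A'} := HB.pack psi psiZ.
by exists psiA.
Qed.

End Homomorphism.

Lemma cancel_morph (T T' : Type) (op : T -> T -> T) (op' : T' -> T' -> T')
    (phi : T -> T') (chi : T' -> T) :
  cancel phi chi -> cancel chi phi -> {morph phi : x y / op x y >-> op' x y} ->
  {morph chi : x y / op' x y >-> op x y}.
Proof. by move=> phiK chiK phiM x y; rewrite -{1}[x]chiK -{1}[y]chiK -phiM. Qed.

(** * Affine homomorphisms *)

Section Affine.
Variables (A : zmodType) (f : {additive A -> A}) (I : Type) (d : I -> A).
Variables (A' : zmodType) (f' : {additive A' -> A'}).
Variables (I' : Type) (d' : I' -> A').
Variables (pi : I -> I') (psi : {additive A -> A'}) (e : I -> A').

Definition affine_map (x : I * A) : I' * A' := (pi x.1, psi x.2 + e x.1).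

(** When [psi f = f' psi], each factor of a product contributes to the failure
    of [affine_map] to be a homomorphism only through this element, see
    [translation_part_affine_map] and [affine_map_right_part]. *)
Definition affine_defect (i : I) : A' :=
  psi (d i) - d' (pi i) - (e i - f' (e i)).

Hypothesis psi_f : forall b, psi (f b) = f' (psi b).

Lemma translation_part_affine_map x :
  translation_part f' d' (affine_map x) =
  psi (translation_part f d x) - affine_defect x.1.
Proof.
rewrite /translation_part /affine_defect /= !(raddfD psi) (raddfD f') raddfN.
rewrite psi_f !opprB.
rewrite -[_ - d' _ + _]addrA addrKA !opprD opprK [_ + _ + (- _ - _)]addrACA.
by rewrite opprK [- _ + e _]addrC [d' _ + _]addrC !addrA.
Qed.

Lemma affine_map_right_part y :
  psi (f y.2 - d y.1) + e y.1 =
  f' (affine_map y).2 - d' (affine_map y).1 - affine_defect y.1.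
Proof.
rewrite /affine_defect /= (raddfB psi) (raddfD f') psi_f !opprB.
rewrite opprD !opprB addrA [_ - d' _ + (_ - _)]addrA subrK.
by rewrite [_ + f' _ - psi _]addrAC [e _ - _]addrC addrA addrK.
Qed.

Lemma affine_map_morph_eq x y :
  affine_map (ext_op f d x y) = ext_op f' d' (affine_map x) (affine_map y) <->
  affine_defect x.1 = affine_defect y.1.
Proof.
rewrite !ext_opE translation_part_affine_map {1}/affine_map /=.
rewrite (raddfD psi) -addrA affine_map_right_part [X in _ <-> X]/=.
rewrite -[_ - affine_defect x.1 + _]addrA [- affine_defect x.1 + _]addrC.
by split=> [[/addrI/addrI/oppr_inj ->] | ->].
Qed.

End Affine.

(** Products inside one fiber force [psi f = f' psi].  Granted this, the
    homomorphism equation for [x] and [y] equates the defects at [x.1] and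
    [y.1], so it holds everywhere when the defect is a constant [a]. *)
Lemma affine_morphP (A : zmodType) (f : {additive A -> A})
    (I : Type) (d : I -> A)
    (A' : zmodType) (f' : {additive A' -> A'}) (I' : Type) (d' : I' -> A')
    (pi : I -> I') (psi : {additive A -> A'}) (e : I -> A') :
  inhabited I ->
  {morph affine_map pi psi e : x y / ext_op f d x y >-> ext_op f' d' x y} <->
  psi \o f = f' \o psi /\
  exists a, forall i, psi (d i) - d' (pi i) = a + (idfun \- f') (e i).
Proof.
case=> i0; split=> [phiM|[fE [a aE]] x y]; last first.
  apply/affine_map_morph_eq => [b|].
    by rewrite -[LHS]/((psi \o f) b) fE.
  by rewrite /affine_defect !aE /= !addrK.
have psi_f b : psi (f b) = f' (psi b).
  (* inside one fiber the constants [d_i] and [d'_(pi i)] cancel *)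
  have := phiM (i0, 0) (i0, b); rewrite /ext_op /affine_map /= => -[].
  rewrite !raddf0 !add0r !addrK (raddfD f') [f' _ + f' _]addrC addrA subrK.
  by rewrite [RHS]addrC => /addIr.
split; first exact/funext.
exists (affine_defect d f' d' pi psi e i0) => i.
have /(affine_map_morph_eq _ _ _ _ psi_f) /= <- := phiM (i, 0) (i0, 0).
by rewrite /affine_defect subrK.
Qed.

Lemma affine_map_bij (I I' : Type) (A A' : zmodType) (pi : I -> I')
    (psi : {additive A -> A'}) (e : I -> A') :
  bijective pi -> bijective psi -> bijective (affine_map pi psi e).
Proof.
move=> [rho piK rhoK] [omega psiK omegaK].
exists (fun y => (rho y.1, omega (y.2 - e (rho y.1)))) => -[i b].
  by rewrite /affine_map /= piK addrK psiK.
by rewrite /affine_map /= rhoK omegaK subrK.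
Qed.

Unset Implicit Arguments.

Theorem theorem8p7
  (A : zmodType) (f : {additive A -> A}) (fbij : bijective f)
  (I : Type) (I_neq0 : inhabited I) (d : I -> A)
  (A' : zmodType) (f' : {additive A' -> A'}) (f'bij : bijective f')
  (I' : Type) (I'_neq0 : inhabited I') (d' : I' -> A')
  (indec : indecomposable d fbij) (indec' : indecomposable d' f'bij) :
  quandle_isomorphic (Ext d fbij) (Ext d' f'bij) <->
  exists (pi : I -> I') (psi : {additive A -> A'}) (a : A'),
    [/\ bijective pi,
        bijective psi,
        psi \o f = f' \o psi
      & forall i : I,
          [set a + u | u in range (idfun \- f')] (psi (d i) - d' (pi i))].
Proof.
split=> [[phi [[chi phiK chiK] phiM]] | [pi [psi [a [pi_bij psi_bij fE aE]]]]].
  have chiM := cancel_morph phiK chiK phiM.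
  have [psi psiP] := translation_morphism phiM I_neq0 indec.
  have [omega omegaP] := translation_morphism chiM I'_neq0 indec'.
  pose pi i := (phi (i, 0)).1; pose e i := (phi (i, 0)).2.
  have phiE : phi = affine_map pi psi e.
    by apply/funext => x; apply: (intertwines_affine psiP).
  move: phiM; rewrite phiE => /(affine_morphP _ _ _ _ _ _ _ I_neq0)[fE [a aE]].
  exists pi, psi, a; split=> //.
  - exists (fun i' => (chi (i', 0)).1).
      exact: (intertwines_base_cancel omegaP phiK).
    exact: (intertwines_base_cancel psiP chiK).
  - exists omega.
      exact: (intertwines_translation_cancel I_neq0 omegaP psiP phiK).
    exact: (intertwines_translation_cancel I'_neq0 psiP omegaP chiK).
  - by move=> i; exists ((idfun \- f') (e i)) => //; exists (e i).
have /choice[e eE] : forall i, exists u,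
    psi (d i) - d' (pi i) = a + (idfun \- f') u.
  by move=> i; have [_ [u _ <-] <-] := aE i; exists u.
exists (affine_map pi psi e); split; first exact: affine_map_bij.
by apply/affine_morphP => //; split=> //; exists a.
Qed.
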